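(* Let $m,n,k\ge1$ be integers, let $A_1,\dots,A_k,\widetilde A_1,\dots,\widetilde A_k\in\mathbb{R}^{m\times n}$, and let $M=[A_1,\dots,A_k]$, $\widetilde M=[\widetilde A_1,\dots,\widetilde A_k]\in\mathbb{R}^{m\times kn}$ be the horizontal concatenations. Set $E_i=\widetilde A_i-A_i$ for $i=1,\dots,k$. Then the matrix $D=\widetilde M^T\widetilde M-M^TM$ satisfies \[ \|D\|_2\le\sqrt{\sum_{i=1}^k\sum_{j=1}^k\bigl(\|A_i\|_2\|E_j\|_2+\|E_i\|_2\|A_j\|_2+\|E_i\|_2\|E_j\|_2\bigr)^2}. \]
   Context: $\|\cdot\|_2$ denotes the spectral (operator) norm of a matrix. *)

(* Defs.v *)
From mathcomp Require Import all_boot all_order all_algebra.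
From mathcomp Require Import all_classical all_reals.

Set Implicit Arguments.
Unset Strict Implicit.
Unset Printing Implicit Defensive.

Import Order.TTheory GRing.Theory Num.Theory.
Local Open Scope classical_set_scope.
Local Open Scope ring_scope.

Definition l2norm (R : realType) (n : nat) (x : 'cV[R]_n) : R :=
  Num.sqrt (\sum_(i < n) x i 0 ^+ 2).

(* The norm that MathComp-Analysis puts on matrices, `|A|, is the largest
   absolute value of an entry, hence a separate definition of the norm induced
   by the Euclidean norms. As [sup] takes a default value on sets without a
   supremum, see [specnorm_has_sup]. *)
Definition specnorm (R : realType) (m n : nat) (A : 'M[R]_(m, n)) : R :=
  sup [set l2norm (A *m x) | x in [set x : 'cV[R]_n | l2norm x <= 1]].

Lemma specnorm_has_sup (R : realType) (m n : nat) (A : 'M[R]_(m, n)) :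
  has_sup [set l2norm (A *m x) | x in [set x : 'cV[R]_n | l2norm x <= 1]].
Proof.
split.
  exists (l2norm (A *m 0)), 0 => //=.
  by rewrite /l2norm big1 ?sqrtr0 // => i _; rewrite mxE expr0n.
exists (Num.sqrt (\sum_i (\sum_j `|A i j|) ^+ 2)) => _ [x /= x1 <-].
have xle1 j : `|x j 0| <= 1.
  apply: le_trans x1; rewrite -sqrtr_sqr ler_sqrt; last first.
    by apply: sumr_ge0 => i _; exact: sqr_ge0.
  by rewrite (bigD1 j) //= lerDl sumr_ge0 // => i _; exact: sqr_ge0.
rewrite ler_sqrt; last by apply: sumr_ge0 => i _; exact: sqr_ge0.
apply: ler_sum => i _; rewrite -[leLHS]real_normK ?num_real //.
rewrite ler_sqr ?nnegrE ?sumr_ge0 // mxE.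
apply: le_trans (ler_norm_sum _ _ _) _; apply: ler_sum => j _.
by rewrite normrM ler_piMr.
Qed.

(* Main.v *)
(** The block of [D] in position [(i, j)] is
    [A_i^T E_j + E_i^T A_j + E_i^T E_j], whose operator norm is at most the
    bracket on the right-hand side because a matrix and its transpose have the
    same norm. So the [i]-th block of [D x] has length at most
    [\sum_j c_ij |x_j|], and the Cauchy-Schwarz inequality over [j] bounds
    [|D x|] by the Frobenius norm of [(c_ij)] times [|x|]. *)
Require Import Defs.
From mathcomp Require Import all_boot all_order all_algebra.
From mathcomp Require Import all_classical all_reals.
From mathcomp Require Import lra.

Import Order.TTheory GRing.Theory Num.Theory.
Local Open Scope ring_scope.

(** Lagrange's identity: twice the difference of the two sides is the double sum of the squares
    [(a i * b j - a j * b i) ^+ 2]. Doubling provides a second copy of the right-hand double sum,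
    whose indices are exchanged so that the comparison becomes termwise. *)
Lemma cauchy_schwarz_sum (R : realDomainType) (I : finType) (a b : I -> R) :
  (\sum_i a i * b i) ^+ 2 <= (\sum_i a i ^+ 2) * (\sum_i b i ^+ 2).
Proof.
rewrite expr2 !big_distrlr /= -(ler_pM2l (ltr0n R 2)) !mulr_natl !mulr2n.
rewrite [X in _ <= _ + X]exchange_big /= -!big_split ler_sum //= => i _.
rewrite -!big_split ler_sum //= => j _.
have := sqr_ge0 (a i * b j - a j * b i); nra.
Qed.

Section EuclideanNorm.
Variable R : realType.
Implicit Types m n k : nat.

Lemma l2norm_ge0 n (x : 'cV[R]_n) : 0 <= l2norm x.
Proof. exact: sqrtr_ge0. Qed.

Lemma sqr_l2norm n (x : 'cV[R]_n) : l2norm x ^+ 2 = \sum_i x i 0 ^+ 2.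
Proof. by rewrite sqr_sqrtr// sumr_ge0// => i _; exact: sqr_ge0. Qed.

Lemma dotmxx n (x : 'cV[R]_n) : (x^T *m x) 0 0 = l2norm x ^+ 2.
Proof. by rewrite sqr_l2norm mxE; apply: eq_bigr => i _; rewrite mxE. Qed.

Lemma dotmx_le n (x y : 'cV[R]_n) : (x^T *m y) 0 0 <= l2norm x * l2norm y.
Proof.
apply: le_trans (ler_norm _) _.
rewrite -ler_sqr ?nnegrE ?mulr_ge0 ?l2norm_ge0// real_normK ?num_real//.
rewrite exprMn !sqr_l2norm mxE; under eq_bigr do rewrite mxE.
exact: cauchy_schwarz_sum.
Qed.

Lemma l2norm0 n : l2norm (0 : 'cV[R]_n) = 0.
Proof. by rewrite /l2norm big1 ?sqrtr0// => i _; rewrite mxE expr0n. Qed.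

Lemma l2normZ n (a : R) (x : 'cV[R]_n) : l2norm (a *: x) = `|a| * l2norm x.
Proof.
rewrite /l2norm -sqrtr_sqr -sqrtrM ?sqr_ge0// mulr_sumr.
by congr Num.sqrt; apply: eq_bigr => i _; rewrite mxE exprMn.
Qed.

Lemma l2norm_eq0 n (x : 'cV[R]_n) : l2norm x = 0 -> x = 0.
Proof.
move=> x0; apply/colP => i; rewrite mxE.
have := sqr_l2norm _ x; rewrite x0 expr0n /= => /esym/psumr_eq0P H.
by apply/eqP; rewrite -sqrf_eq0 H// => j _; exact: sqr_ge0.
Qed.

Lemma l2normD n (x y : 'cV[R]_n) : l2norm (x + y) <= l2norm x + l2norm y.
Proof.
rewrite -ler_sqr ?nnegrE ?addr_ge0 ?l2norm_ge0// -dotmxx.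
rewrite [(x + y)^T]linearD /= mulmxDl !mulmxDr.
rewrite ![((_ + _) : 'M_(_, _)) _ _]mxE !dotmxx.
have := dotmx_le _ x y; have := dotmx_le _ y x; lra.
Qed.

Lemma l2norm_sum n (I : finType) (x : I -> 'cV[R]_n) :
  l2norm (\sum_i x i) <= \sum_i l2norm (x i).
Proof.
elim/big_ind2: _ => [|x1 a x2 b xa xb|//]; first by rewrite l2norm0.
exact: le_trans (l2normD _ _ _) (lerD xa xb).
Qed.

Lemma sqr_l2norm_mxcol k (p : 'I_k -> nat) (x : forall i, 'cV[R]_(p i)) :
  l2norm (\mxcol_i x i) ^+ 2 = \sum_i l2norm (x i) ^+ 2.
Proof.
rewrite -dotmxx tr_mxcol mul_mxrow_mxcol summxE.
by apply: eq_bigr => i _; rewrite dotmxx.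
Qed.

Lemma specnorm_ub m n (A : 'M[R]_(m, n)) (x : 'cV[R]_n) :
  l2norm x <= 1 -> l2norm (A *m x) <= specnorm A.
Proof.
move=> x1; apply: sup_upper_bound; first exact: specnorm_has_sup.
by exists x.
Qed.

Lemma specnorm_ge0 m n (A : 'M[R]_(m, n)) : 0 <= specnorm A.
Proof.
by have := specnorm_ub _ _ A 0; rewrite mulmx0 !l2norm0; apply.
Qed.

Lemma l2norm_mulmx_le m n (A : 'M[R]_(m, n)) (x : 'cV[R]_n) :
  l2norm (A *m x) <= specnorm A * l2norm x.
Proof.
have [/l2norm_eq0 ->|x0] := eqVneq (l2norm x) 0.
  by rewrite mulmx0 !l2norm0 mulr0.
have xgt0 : 0 < l2norm x by rewrite lt0r x0 l2norm_ge0.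
(* The supremum ranges over the unit ball, so the nonzero [x] is normalised first. *)
have := specnorm_ub _ _ A ((l2norm x)^-1 *: x).
rewrite -scalemxAr !l2normZ ger0_norm ?invr_ge0 ?l2norm_ge0// mulVf// lexx.
by rewrite ler_pdivrMl// mulrC; apply.
Qed.

(** With [z = A^T *m y], the square [|z|^2] is the inner product of [A *m z] and [y], hence at most
    [|A| |z| |y|]; a nonzero [|z|] cancels. This is the half of the equality of the norms of [A] and
    [A^T] that the block bounds use. *)
Lemma l2norm_trmx_mulmx_le m n (A : 'M[R]_(m, n)) (y : 'cV[R]_m) :
  l2norm (A^T *m y) <= specnorm A * l2norm y.
Proof.
have [->|z0] := eqVneq (l2norm (A^T *m y)) 0.
  by rewrite mulr_ge0 ?specnorm_ge0 ?l2norm_ge0.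
have zgt0 : 0 < l2norm (A^T *m y) by rewrite lt0r z0 l2norm_ge0.
rewrite -(ler_pM2l zgt0) -expr2 -dotmxx mulmxA -trmx_mul.
apply: le_trans (dotmx_le _ _ _) _.
rewrite mulrA ler_wpM2r ?l2norm_ge0// [leRHS]mulrC.
exact: l2norm_mulmx_le.
Qed.

Lemma l2norm_gram_le m n1 n2 (A : 'M[R]_(m, n1)) (B : 'M[R]_(m, n2))
    (x : 'cV[R]_n2) :
  l2norm (A^T *m (B *m x)) <= specnorm A * specnorm B * l2norm x.
Proof.
apply: le_trans (l2norm_trmx_mulmx_le _ _ _ _) _; rewrite -mulrA.
by rewrite ler_wpM2l ?specnorm_ge0 ?l2norm_mulmx_le.
Qed.

Lemma specnorm_le m n (A : 'M[R]_(m, n)) (c : R) : 0 <= c ->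
  (forall x, l2norm (A *m x) <= c * l2norm x) -> specnorm A <= c.
Proof.
move=> c0 Ac; apply: ge_sup; first by have [] := specnorm_has_sup A.
by move=> _ [x /= x1 <-]; rewrite (le_trans (Ac x))// ler_piMr.
Qed.

(** The products are bracketed as [(A i)^T *m (A j *m x j)] to fit [l2norm_gram_le]. *)
Lemma mulmx_gram_mxrow m n k (A : 'I_k -> 'M[R]_(m, n))
    (x : 'I_k -> 'cV[R]_n) :
  (\mxrow_i A i)^T *m (\mxrow_i A i) *m (\mxcol_i x i)
  = \mxcol_i \sum_j (A i)^T *m (A j *m x j).
Proof.
rewrite -mulmxA mul_mxrow_mxcol tr_mxrow mxcol_mul.
by apply: eq_mxcol => i; rewrite mulmx_sumr.
Qed.

End EuclideanNorm.

Theorem lemma1 (R : realType) (m n k : nat)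
    (m_gt0 : (0 < m)%N) (n_gt0 : (0 < n)%N) (k_gt0 : (0 < k)%N)
    (A A' : 'I_k -> 'M[R]_(m, n)) :
  let M := \mxrow_(i < k) A i in
  let M' := \mxrow_(i < k) A' i in
  let E := fun i : 'I_k => A' i - A i in
  let D := M'^T *m M' - M^T *m M in
  specnorm D <=
    Num.sqrt (\sum_(i < k) \sum_(j < k)
      (specnorm (A i) * specnorm (E j) + specnorm (E i) * specnorm (A j)
       + specnorm (E i) * specnorm (E j)) ^+ 2).
Proof.
lazy zeta; set E := fun i => A' i - A i.
set c := fun i j : 'I_k => specnorm (A i) * specnorm (E j)
  + specnorm (E i) * specnorm (A j) + specnorm (E i) * specnorm (E j).
set S := (X in Num.sqrt X).
apply: specnorm_le => [|x]; first exact: sqrtr_ge0.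
have c2_ge0 i : 0 <= \sum_j c i j ^+ 2.
  by rewrite sumr_ge0// => j _; exact: sqr_ge0.
(* Both sides are squared because the squared norm of a block column is the sum of the squared norms
   of its blocks. *)
rewrite -ler_sqr ?nnegrE ?mulr_ge0 ?sqrtr_ge0 ?l2norm_ge0// exprMn.
have S_ge0 : 0 <= S by apply: sumr_ge0 => i _; exact: c2_ge0.
rewrite (sqr_sqrtr S_ge0).
rewrite -(submxcolK x); set y := fun j => submxcol x j.
have block i : \sum_j (A' i)^T *m (A' j *m y j)
      - \sum_j (A i)^T *m (A j *m y j)
    = \sum_j ((A i)^T *m (E j *m y j) + (E i)^T *m (A j *m y j)
              + (E i)^T *m (E j *m y j)).
  rewrite -sumrB; apply: eq_bigr => j _.
  have -> : A' i = A i + E i by rewrite addrC subrK.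
  have -> : A' j = A j + E j by rewrite addrC subrK.
  rewrite [(_ + _)^T]linearD /= !mulmxDl !mulmxDr.
  (* The term [(A i)^T *m (A j *m y j)] cancels, and each of the three remaining terms contains a
     perturbation. *)
  by rewrite -!addrA addrC !addrA addrNK.
(* Distributing [S] over its outer sum allows a separate comparison for each block row [i]. *)
rewrite mulmxBl !mulmx_gram_mxrow -mxcolB !sqr_l2norm_mxcol /S mulr_suml.
apply: ler_sum => i _; rewrite block.
(* It remains to bound the norm of block [i] by [\sum_j c i j * l2norm (y j)]. *)
apply: le_trans (cauchy_schwarz_sum _ _ (c i) (fun j => l2norm (y j))).
have c_ge0 j : 0 <= c i j by rewrite !addr_ge0 ?mulr_ge0 ?specnorm_ge0.
rewrite ler_sqr ?nnegrE ?l2norm_ge0 ?sumr_ge0//; last first.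
  by move=> j _; rewrite mulr_ge0 ?l2norm_ge0.
apply: le_trans (l2norm_sum _ _ _ _) _; apply: ler_sum => j _.
(* The three summands of [c i j] bound the three terms of the block one by one. *)
rewrite !mulrDl; apply: le_trans (l2normD _ _ _ _) (lerD _ _).
  by apply: le_trans (l2normD _ _ _ _) (lerD _ _); exact: l2norm_gram_le.
exact: l2norm_gram_le.
Qed.
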